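(* Suppose that $f$ has the MLR property, i.e. $f(x_1-\eta_1)f(x_2-\eta_2)\ge f(x_1-\eta_2)f(x_2-\eta_1)$ whenever $x_1<x_2$ and $\eta_1<\eta_2$. Let $\delta_\phi(\mathbf X)=X_{(2)}-\phi(U)$ be a location equivariant estimator of $\theta_{(2)}$ such that (i) $\phi(t)$ is increasing in $t$; (ii) $\lim_{t\to\infty}\phi(t)=b_0$, where $b_0=2\int_{-\infty}^{\infty}xf(x)F(x)\,dx$; (iii) $\displaystyle \phi(t)\ge\frac{\int_{-\infty}^{\infty}\int_0^t zf(z-u)f(z)\,du\,dz}{\int_{-\infty}^{\infty}\int_0^t f(z-u)f(z)\,du\,dz}$ for all $t>0$. Then $\delta_\phi$ improves upon $\delta_{b_0}(\mathbf X)=X_{(2)}-b_0$ under the squared error loss $(a-\theta_{(2)})^2$, in the sense that $R(\boldsymbol\theta,\delta_\phi)\le R(\boldsymbol\theta,\delta_{b_0})$ for all $\boldsymbol\theta\in\mathbb{R}^2$.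
   Context: Setting: $f$ is a Lebesgue probability density on $\mathbb{R}$ with distribution function $F(x)=\int_{-\infty}^x f(t)\,dt$; $X_1,X_2$ are independent and $X_i$ has density $x\mapsto f(x-\theta_i)$, where $\boldsymbol\theta=(\theta_1,\theta_2)\in\mathbb{R}^2$ is unknown. Write $\theta_{(2)}=\max\{\theta_1,\theta_2\}$, $X_{(1)}=\min\{X_1,X_2\}$, $X_{(2)}=\max\{X_1,X_2\}$, $U=X_{(2)}-X_{(1)}$, $\mathbf X=(X_1,X_2)$, $\phi:[0,\infty)\to\mathbb{R}$. The risk of $\delta$ is $R(\boldsymbol\theta,\delta)=E_{\boldsymbol\theta}[(\delta(\mathbf X)-\theta_{(2)})^2]$. Standing assumption: all integrals involving the loss are finite and differentiation under the integral sign is permissible. *)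

(* Defs.v *)
From HB Require Import structures.
From mathcomp Require Import all_boot all_order all_algebra.
From mathcomp Require Import all_classical all_reals all_analysis.

Set Implicit Arguments.
Unset Strict Implicit.
Unset Printing Implicit Defensive.

Import Order.TTheory GRing.Theory Num.Theory.
Import numFieldNormedType.Exports.

Local Open Scope classical_set_scope.
Local Open Scope ring_scope.

Section densities.
Context {R : realType}.
Implicit Types (f : R -> R) (t : R).

Local Notation mu := (@lebesgue_measure R).

Definition prob_density f :=
  [/\ measurable_fun [set: R] f,
      forall x, 0 <= f x
    & (\int[mu]_x (f x)%:E = 1)%E].

Definition cdf_of f (x : R) : R := \int[mu]_(t in `]-oo, x]) f t.

Definition mlr f := forall x1 x2 eta1 eta2 : R, x1 < x2 -> eta1 < eta2 ->
  f (x1 - eta2) * f (x2 - eta1) <= f (x1 - eta1) * f (x2 - eta2).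

Definition b0 f : R := 2 * \int[mu]_x (x * f x * cdf_of f x).

Definition phi_bound f t : R :=
  (\int[mu]_z \int[mu]_(u in `[0, t]) (z * f (z - u) * f z)) /
  (\int[mu]_z \int[mu]_(u in `[0, t]) (f (z - u) * f z)).

End densities.

Section model.
Context {d : measure_display} {T : measurableType d} {R : realType}.
Implicit Types (P : probability T R) (X Y : {mfun T >-> R}).

Definition has_density P X (g : R -> R) := forall A : set R, measurable A ->
  (distribution P X A = \int[@lebesgue_measure R]_(x in A) (g x)%:E)%E.

Definition independent_RVs P X Y := forall A B : set R,
  measurable A -> measurable B ->
  (P (X @^-1` A `&` Y @^-1` B) = P (X @^-1` A) * P (Y @^-1` B))%E.

(* The law of the sample depends on theta, the sample space and the
   observations do not. *)
Definition location_model (P : R * R -> probability T R) X1 X2 (f : R -> R) :=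
  forall theta : R * R,
    [/\ has_density (P theta) X1 (fun x => f (x - theta.1)),
        has_density (P theta) X2 (fun x => f (x - theta.2))
      & independent_RVs (P theta) X1 X2].

(* Extended-real valued: no integrability is built in. *)
Definition risk (P : R * R -> probability T R) X1 X2
    (theta : R * R) (delta : R * R -> R) : \bar R :=
  'E_(P theta)[fun w => (delta (X1 w, X2 w) - Num.max theta.1 theta.2) ^+ 2].

End model.

(* phi is only ever evaluated on [0, +oo[. *)
Definition delta_phi {R : realType} (phi : R -> R) (x : R * R) : R :=
  Num.max x.1 x.2 - phi (Num.max x.1 x.2 - Num.min x.1 x.2).

Definition delta_const {R : realType} (b : R) (x : R * R) : R :=
  Num.max x.1 x.2 - b.

(* Main.v *)
Require Import Defs.
From HB Require Import structures.
From mathcomp Require Import ring lra.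
From mathcomp Require Import all_boot all_order all_algebra.
From mathcomp Require Import all_classical all_reals all_analysis.
From mathcomp Require Import measurable_realfun.

Set Implicit Arguments.
Unset Strict Implicit.
Unset Printing Implicit Defensive.

Import Order.TTheory GRing.Theory Num.Theory.
Import numFieldNormedType.Exports.

Local Open Scope classical_set_scope.
Local Open Scope ring_scope.

(* Let Z = max X - theta_(2), U the range of the sample and
   l = |theta_1 - theta_2|. On {U <= t} the variable Z has density proportional to
   h_l(z) = f(z) W(z + l) + f(z + l) W(z), where W(z) is the integral of f over
   [z - t, z]. Both f and W have monotone likelihood ratio, so h_l / h_0 is
   nonincreasing, whence E[Z | U <= t] is largest at l = 0, where hypothesis (iii)
   bounds it by phi(t).
   Since phi increases to b0, the gain (Z - b0)^2 - (Z - phi(U))^2 is the integral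
   of 2 (s - Z) over phi(U) < s < b0. Each event {phi(U) < s} is {U <= t} or
   {U < t} for some t, so exchanging the integrals makes every layer contribute a
   nonnegative expectation. *)

(** * Change of variables and joint laws *)

(** Since [phi] is merely monotone, the gain cannot be written through a derivative of [phi];
    cutting it along levels s asks only for level sets. The obstacle is then integrability, as
    E[Z | U <= t] and the signed layers 2 (s - Z) make sense only with moments. So every comparison
    is stated as a balance, E[(Z - s)^+; U <= t] <= E[(s - Z)^+; U <= t], between integrals of
    nonnegative functions, to which Tonelli and monotone convergence apply directly. Finite second
    moments enter at two places: to read the ratio in (iii) as a balance at l = 0, and to cancel
    finite terms at the very end. At l = 0 one has h_0 = 2 f W; the factor 2 is dropped, and the
    ratio in (iii) is the mean of the law with density proportional to f W. *)

Lemma ge0_integral_reflect (R : realType) (c : R) (g : R -> \bar R) :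
  measurable_fun [set: R] g -> (forall x, 0 <= g x)%E ->
  (\int[lebesgue_measure]_x g (c - x)%R = \int[lebesgue_measure]_x g x)%E.
Proof.
move=> mg g0.
pose r : measurableTypeR R -> measurableTypeR R := fun x : R => c - x.
have mr : measurable_fun [set: measurableTypeR R] r.
  exact: (@measurable_funB _ R _ _ (cst c) id).
transitivity (\int[pushforward lebesgue_measure r]_x g x)%E.
  by rewrite ge0_integral_pushforward// => y _; exact: g0.
apply: eq_measure_integral => //= A mA _; apply/esym.
apply: lebesgue_measure_unique => //= _ [[a b]] _ <-.
rewrite /pushforward.
(* Reflection exchanges the open and the closed end, which does not change the length. *)
have -> : r @^-1` `]a, b]%classic = `[c - b, c - a[%classic.
  by apply/seteqP; split => x /=; rewrite /r !in_itv/= => /andP[? ?];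
    apply/andP; split; lra.
rewrite !lebesgue_measure_itv/= !lte_fin ltrD2l ltrN2; case: ifP => // _.
by rewrite -!EFinD; congr (_%:E); ring.
Qed.

(** A shift is a composition of two reflections, x + c = c - (0 - x). *)
Lemma ge0_integral_shift (R : realType) (c : R) (g : R -> \bar R) :
  measurable_fun [set: R] g -> (forall x, 0 <= g x)%E ->
  (\int[lebesgue_measure]_x g (x + c)%R = \int[lebesgue_measure]_x g x)%E.
Proof.
move=> mg g0.
rewrite -[RHS](@ge0_integral_reflect _ c)//.
rewrite -[RHS](@ge0_integral_reflect _ 0)//.
  by apply: eq_integral => x _; congr g; ring.
by apply: measurableT_comp => //; exact: measurable_funB.
Qed.

(* The measurable structure of [R] as a codomain of random variables and the
   one carrying [lebesgue_measure] have the same measurable sets but different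
   displays, hence the cast. *)
Definition borel_rv d (T : measurableType d) (R : realType)
    (X : {mfun T >-> R}) : T -> measurableTypeR R := X.

HB.instance Definition _ d (T : measurableType d) (R : realType)
    (X : {mfun T >-> R}) :=
  isMeasurableFun.Build _ _ _ _ (borel_rv X)
    (@measurable_funPT _ _ _ _ X : measurable_fun setT (borel_rv X)).

(** [has_density] describes the law on sets only. It makes the law absolutely continuous, and [g]
    agrees almost everywhere with the Radon-Nikodym derivative, to which the change of variables
    applies. *)
Lemma ge0_integral_density d (T : measurableType d) (R : realType)
    (P : probability T R) (X : {mfun T >-> R}) (g : R -> R) (h : R -> \bar R) :
  measurable_fun [set: R] g -> has_density P X g ->
  measurable_fun [set: R] h -> (forall x, 0 <= h x)%E ->
  (\int[distribution P (borel_rv X)]_x h x =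
   \int[lebesgue_measure]_x (h x * (g x)%:E))%E.
Proof.
move=> mg dX mh h0.
pose mu : {sigma_finite_measure set (measurableTypeR R) -> \bar R} :=
  @lebesgue_measure R.
pose nu : {finite_measure set (measurableTypeR R) -> \bar R} :=
  distribution P (borel_rv X).
have mgE : measurable_fun [set: R] (EFin \o g) by exact/measurable_EFinP.
have nuE A : measurable A -> nu A = (\int[mu]_(x in A) (g x)%:E)%E.
  by move=> mA; exact: dX.
have numu : nu `<< mu.
  apply/null_content_dominatesP => A mA A0.
  rewrite nuE//; apply: null_set_integral => //.
  exact: measurable_funS mgE.
rewrite -(Radon_Nikodym_SigmaFinite.change_of_variables numu)//.
have ifnu := Radon_Nikodym_SigmaFinite.f_integrable numu.
apply: ae_eq_integral => //.
- by apply: emeasurable_funM => //; exact: measurable_int ifnu.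
- exact: emeasurable_funM.
- apply: ae_eqe_mul2l; apply: integral_ae_eq => //.
  by move=> E _ mE; rewrite -Radon_Nikodym_SigmaFinite.f_integral// nuE.
Qed.

Lemma ge0_expectation_indep d (T : measurableType d) (R : realType)
    (P : probability T R) (X Y : {mfun T >-> R}) (g1 g2 : R -> R)
    (h : R -> R -> \bar R) :
  measurable_fun [set: R] g1 -> has_density P X g1 ->
  measurable_fun [set: R] g2 -> has_density P Y g2 ->
  independent_RVs P X Y ->
  measurable_fun [set: R * R] (fun z : R * R => h z.1 z.2) ->
  (forall x y, 0 <= h x y)%E ->
  (\int[P]_w h (X w) (Y w) =
   \int[lebesgue_measure]_x
     ((\int[lebesgue_measure]_y (h x y * (g2 y)%:E)) * (g1 x)%:E))%E.
Proof.
move=> mg1 dX mg2 dY iXY mh h0.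
pose T2 := (measurableTypeR R * measurableTypeR R)%type.
pose V : T -> T2 := fun w => (borel_rv X w, borel_rv Y w).
have mV : measurable_fun setT V by exact: measurable_fun_pair.
pose V' := HB.pack_for {mfun T >-> T2} V (isMeasurableFun.Build _ _ _ _ _ mV).
pose H : T2 -> \bar R := fun z => h z.1 z.2.
have mH : measurable_fun [set: T2] H by exact: mh.
transitivity (\int[distribution P V']_z H z)%E.
  by rewrite ge0_integral_distribution// => y; exact: h0.
transitivity (\int[distribution P (borel_rv X) \x distribution P (borel_rv Y)]_z
    H z)%E.
  (* Independence identifies the joint law with the product measure on rectangles, hence
     everywhere. *)
  apply: eq_measure_integral => A mA _; apply/esym.
  exact: product_measure_unique.
rewrite fubini_tonelli1//; last by move=> z; exact: h0.
have inner x : (fubini_F (distribution P (borel_rv Y)) H x =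
    \int[lebesgue_measure]_y (h x y * (g2 y)%:E))%E.
  rewrite -(ge0_integral_density mg2 dY)//.
  exact: (measurableT_comp mH (pair1_measurable x)).
under [RHS]eq_integral do rewrite -inner.
rewrite -(ge0_integral_density mg1 dX)//.
- by apply: measurable_fun_fubini_tonelli_F => // z; exact: h0.
- by move=> x; apply: integral_ge0 => y _; exact: h0.
Qed.

(** * The joint law of the maximum and the range *)

(** The W of the overview, in the variable u = z - x so as to match the inner integrals of
    [phi_bound]. *)
Definition window {R : realType} (f : R -> R) (t z : R) : R :=
  \int[lebesgue_measure]_(u in `[0, t]) f (z - u).

Lemma measurable_reflect (R : realType) d (U : measurableType d) (f : R -> U)
    (c : R) :
  measurable_fun [set: R] f -> measurable_fun [set: R] (fun u => f (c - u)).
Proof.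
by move=> mf; apply: measurableT_comp => //; exact: measurable_funB.
Qed.

Lemma measurable_shift (R : realType) d (U : measurableType d) (f : R -> U)
    (c : R) :
  measurable_fun [set: R] f -> measurable_fun [set: R] (fun u => f (u + c)).
Proof.
by move=> mf; apply: measurableT_comp => //; exact: measurable_funD.
Qed.

Lemma integrable_density (R : realType) (f : R -> R) (D : set R) :
  prob_density f -> measurable D ->
  lebesgue_measure.-integrable D (EFin \o f).
Proof.
move=> [mf f0 f1] mD; apply: (@integrableS _ _ _ _ setT) => //.
apply/integrableP; split; first exact/measurable_EFinP.
by under eq_integral do rewrite /= ger0_norm//; rewrite f1 ltry.
Qed.

Lemma prob_density_reflect (R : realType) (f : R -> R) (c : R) :
  prob_density f -> prob_density (fun u => f (c - u)).
Proof.
move=> [mf f0 f1]; split => //; first exact: measurable_reflect.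
rewrite -f1 -[RHS](@ge0_integral_reflect _ c (EFin \o f))//.
exact/measurable_EFinP.
Qed.

Lemma prob_density_shift (R : realType) (f : R -> R) (c : R) :
  prob_density f -> prob_density (fun u => f (u + c)).
Proof.
move=> [mf f0 f1]; split => //; first exact: measurable_shift.
rewrite -f1 -[RHS](@ge0_integral_shift _ c (EFin \o f))//.
exact/measurable_EFinP.
Qed.

Lemma windowE (R : realType) (f : R -> R) (t z : R) : prob_density f ->
  ((window f t z)%:E = \int[lebesgue_measure]_(u in `[0%R, t]) (f (z - u))%:E)%E.
Proof.
move=> df; rewrite /window/Rintegral fineK//.
apply: integrable_fin_num => //.
exact: (@integrable_density _ (fun u => f (z - u)) _ (prob_density_reflect z df)).
Qed.

Lemma window_ge0 (R : realType) (f : R -> R) (t z : R) : prob_density f ->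
  0 <= window f t z.
Proof. by move=> [_ f0 _]; apply: Rintegral_ge0 => u _; exact: f0. Qed.

Lemma window_le1 (R : realType) (f : R -> R) (t z : R) : prob_density f ->
  window f t z <= 1.
Proof.
move=> df; rewrite -lee_fin windowE//.
have [mg g0 <-] := prob_density_reflect z df.
apply: ge0_subset_integral => //=; first exact/measurable_EFinP.
by move=> x _; rewrite lee_fin.
Qed.

Lemma measurable_window (R : realType) (f : R -> R) (t : R) : prob_density f ->
  measurable_fun [set: R] (window f t).
Proof.
move=> df; have [mf f0 _] := df; apply/measurable_EFinP.
(* Moving the range of u into the integrand makes [window] a section integral on the plane,
   measurable by Tonelli. *)
pose k (z : R * measurableTypeR R) : \bar R :=
  if 0 <= (z.2 : R) <= t then (f (z.1 - z.2))%:E else 0%E.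
have m2 : measurable_fun [set: R * measurableTypeR R] (fun z => z.2 : R).
  exact: measurable_snd.
have mk : measurable_fun [set: R * measurableTypeR R] k.
  apply: measurable_fun_ifT => //.
    by apply: measurable_and; apply: measurable_fun_ler.
  by apply/measurable_EFinP/measurableT_comp => //; exact: measurable_funB.
have -> : EFin \o window f t = fubini_F lebesgue_measure k.
  apply/funext => z; rewrite /fubini_F/= windowE// integral_mkcond.
  apply: eq_integral => u _; rewrite patchE /k/=; case: ifPn => [|].
    by rewrite inE/= in_itv/= => ->.
  by rewrite notin_setE/= in_itv/= => /negP/negbTE ->.
apply: measurable_fun_fubini_tonelli_F => // z.
by rewrite /k; case: ifP => // _; rewrite lee_fin.
Qed.

(** Integrates out the smaller observation x when the larger one is y and the range is at most t;
    [k] carries the factor depending on y alone. *)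
Lemma integral_closed_window (R : realType) (f : R -> R) (t y a : R) (k : \bar R) :
  prob_density f -> (0 <= k)%E ->
  (\int[lebesgue_measure]_x
    ((if (y - t <= x <= y)%R then k else 0) * (f (x - a)%R)%:E) =
   k * (window f t (y - a)%R)%:E)%E.
Proof.
move=> df k0; have [mf f0 _] := df.
have mh : measurable_fun [set: R]
    (fun x => if y - t <= x <= y then (f (x - a))%:E else 0%E).
  apply: measurable_fun_ifT => //.
    by apply: measurable_and; apply: measurable_fun_ler.
  by apply/measurable_EFinP; exact: measurable_shift.
have h0 x : (0 <= if (y - t <= x <= y)%R then (f (x - a))%:E else 0)%E.
  by case: ifP => // _; rewrite lee_fin.
transitivity (\int[lebesgue_measure]_x
    (k * if (y - t <= x <= y)%R then (f (x - a))%:E else 0))%E.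
  by apply: eq_integral => x _; case: ifP => _; rewrite ?mule0 ?mul0e.
rewrite ge0_integralZl//; congr (k * _)%E.
rewrite -(@ge0_integral_reflect _ y)// windowE// [RHS]integral_mkcond.
apply: eq_integral => u _; rewrite patchE.
have -> : (u \in `[0, t]%classic) = (y - t <= y - u <= y).
  rewrite mem_setE in_itv/=; apply/idP/idP => /andP[? ?]; apply/andP; split; lra.
by case: ifP => // _; congr (f _)%:E; ring.
Qed.

(** Ties must be counted once, so one of the two orderings is strict; this removes only the null
    point y. *)
Lemma integral_halfopen_window (R : realType) (f : R -> R) (t y a : R) (k : \bar R) :
  prob_density f -> (0 <= k)%E ->
  (\int[lebesgue_measure]_x
    ((if (y - t <= x < y)%R then k else 0) * (f (x - a)%R)%:E) =
   k * (window f t (y - a)%R)%:E)%E.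
Proof.
move=> df k0; have [mf f0 _] := df; rewrite -integral_closed_window//.
have mfa : measurable_fun [set: R] (fun x => (f (x - a))%:E).
  by apply/measurable_EFinP; exact: measurable_shift.
apply: ge0_ae_eq_integral => //.
- apply: emeasurable_funM => //; apply: measurable_fun_ifT => //.
  by apply: measurable_and; [exact: measurable_fun_ler|exact: measurable_fun_ltr].
- apply: emeasurable_funM => //; apply: measurable_fun_ifT => //.
  by apply: measurable_and; exact: measurable_fun_ler.
- by move=> x _; apply: mule_ge0; rewrite ?lee_fin//; case: ifP.
- by move=> x _; apply: mule_ge0; rewrite ?lee_fin//; case: ifP.
exists [set y]; split => //; first exact: lebesgue_measure_set1.
move=> x /= xy; apply: contrapT => /eqP xny; apply: xy => _.
by rewrite lt_neqAle xny.
Qed.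

Lemma measurable_if_between d (T : measurableType d) (R : realType)
    (l m u : T -> R) (q : T -> \bar R) :
  measurable_fun setT l -> measurable_fun setT m -> measurable_fun setT u ->
  measurable_fun setT q ->
  measurable_fun setT (fun x => if l x <= m x <= u x then q x else 0%E).
Proof.
move=> ml mm mu mq; apply: measurable_fun_ifT => //.
by apply: measurable_and; apply: measurable_fun_ler.
Qed.

Lemma measurable_if_betweenco d (T : measurableType d) (R : realType)
    (l m u : T -> R) (q : T -> \bar R) :
  measurable_fun setT l -> measurable_fun setT m -> measurable_fun setT u ->
  measurable_fun setT q ->
  measurable_fun setT (fun x => if l x <= m x < u x then q x else 0%E).
Proof.
move=> ml mm mu mq; apply: measurable_fun_ifT => //.
by apply: measurable_and; [exact: measurable_fun_ler|exact: measurable_fun_ltr].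
Qed.

(* The two summands of the density come from [X <= Y] and from [Y < X]. *)
Lemma expectation_max_range d (T : measurableType d) (R : realType)
    (P : probability T R) (X Y : {mfun T >-> R}) (f : R -> R) (a b t : R)
    (q : R -> \bar R) :
  prob_density f ->
  has_density P X (fun x => f (x - a)) -> has_density P Y (fun x => f (x - b)) ->
  independent_RVs P X Y ->
  measurable_fun [set: R] q -> (forall x, 0 <= q x)%E ->
  (\int[P]_w (if (Num.max (X w) (Y w) - Num.min (X w) (Y w) <= t)%R
              then q (Num.max (X w) (Y w) - b)%R else 0) =
   \int[lebesgue_measure]_z (q z *
     (f z * window f t (z + (b - a)) + f (z + (b - a)) * window f t z)%R%:E))%E.
Proof.
move=> df dX dY iXY mq q0; have [mf f0 _] := df.
have mqb : measurable_fun [set: R] (fun x => q (x - b)).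
  by apply: measurableT_comp => //; exact: measurable_funB.
have mfs c : measurable_fun [set: R] (fun x => f (x - c)).
  exact: measurable_shift.
have mw := measurable_window t df.
have mwE c : measurable_fun [set: R] (fun x => (window f t (x - c))%:E).
  by apply/measurable_EFinP; exact: (@measurable_shift _ _ _ (window f t)).
have w0 := fun z => window_ge0 t z df.
have iYX : independent_RVs P Y X.
  by move=> A B mA mB; rewrite setIC iXY// muleC.
pose h1 x y := if y - t <= x <= y then q (y - b) else 0%E.
pose h2 x y := if x - t <= y < x then q (x - b) else 0%E.
have h1_ge0 x y : (0 <= h1 x y)%E by rewrite /h1; case: ifP.
have h2_ge0 x y : (0 <= h2 x y)%E by rewrite /h2; case: ifP.
have mh1 : measurable_fun [set: R * R] (fun z : R * R => h1 z.2 z.1).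
  apply: measurable_if_between => //; first exact: measurable_funB.
  exact: measurableT_comp mqb measurable_fst.
have mh2 : measurable_fun [set: R * R] (fun z : R * R => h2 z.1 z.2).
  apply: measurable_if_betweenco => //; first exact: measurable_funB.
  exact: measurableT_comp mqb measurable_fst.
transitivity (\int[P]_w (h1 (X w) (Y w) + h2 (X w) (Y w)))%E.
  apply: eq_integral => w _; rewrite /h1 /h2.
  have [xy|yx] := leP (X w) (Y w).
    rewrite andbF adde0 andbT; congr (if _ then _ else _).
    by rewrite lerBlDl lerBlDr.
  rewrite andbF add0e andbT; congr (if _ then _ else _).
  by rewrite lerBlDl lerBlDr.
rewrite ge0_integralD//; last 2 first.
- have : measurable_fun [set: T] (fun w => (Y w, X w)).
    exact: measurable_fun_pair.
  exact: (measurableT_comp mh1).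
- have : measurable_fun [set: T] (fun w => (X w, Y w)).
    exact: measurable_fun_pair.
  exact: (measurableT_comp mh2).
rewrite (ge0_expectation_indep (h := fun y x => h1 x y) _ dY _ dX iYX)//.
rewrite (ge0_expectation_indep (h := h2) _ dX _ dY iXY)//.
under eq_integral do rewrite integral_closed_window//.
under [X in (_ + X)%E]eq_integral do rewrite integral_halfopen_window//.
have mK c e : measurable_fun [set: R]
    (fun y => q (y - b)%R * (window f t (y - c)%R)%:E * (f (y - e)%R)%:E)%E.
  by apply: emeasurable_funM; [exact: emeasurable_funM|exact/measurable_EFinP].
have K0 c e (y : R) :
    (0 <= q (y - b)%R * (window f t (y - c)%R)%:E * (f (y - e)%R)%:E)%E.
  by rewrite !mule_ge0// lee_fin.
(* In both integrals the remaining variable is the maximum; shifting by b turns it into its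
   deviation z from b. *)
have mKs c e := measurable_shift b (mK c e).
rewrite -[X in (X + _)%E](@ge0_integral_shift _ b)//.
rewrite -[X in (_ + X)%E](@ge0_integral_shift _ b)//.
rewrite -ge0_integralD//; [|exact: mKs..].
apply: eq_integral => z _; rewrite !addrK -!addrA -!muleA -!EFinM.
rewrite -ge0_muleDr ?lee_fin ?mulr_ge0// -EFinD.
by rewrite mulrC [in X in _ + X]mulrC.
Qed.

(** * Monotone likelihood ratio *)

(** The division-free form of: f(. + l) / f is nonincreasing. *)
Lemma mlr_shift (R : realType) (f : R -> R) (l p q : R) : mlr f -> 0 <= l ->
  p <= q -> f p * f (q + l) <= f (p + l) * f q.
Proof.
move=> mf; rewrite le_eqVlt => /predU1P[<- _|l0]; first by rewrite !addr0.
rewrite le_eqVlt => /predU1P[->|pq]; first by rewrite mulrC.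
have /(_ _ _)/= := mf (p + l) (q + l) 0 l.
by rewrite !subr0 !addrK ltrD2r; exact.
Qed.

Lemma mlr_Rintegral (R : realType) (f : R -> R) (l : R) (A B : set R) :
  prob_density f -> mlr f -> 0 <= l -> measurable A -> measurable B ->
  (forall p q, A p -> B q -> p <= q) ->
  (\int[lebesgue_measure]_(p in A) f p) *
    (\int[lebesgue_measure]_(q in B) f (q + l)) <=
  (\int[lebesgue_measure]_(p in A) f (p + l)) *
    (\int[lebesgue_measure]_(q in B) f q).
Proof.
move=> df mf l0 mA mB AB.
have dfl := prob_density_shift l df.
have iD D : measurable D -> lebesgue_measure.-integrable D (EFin \o f).
  exact: integrable_density.
have iDl D : measurable D ->
    lebesgue_measure.-integrable D (EFin \o (fun x => f (x + l))).
  exact: integrable_density dfl.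
have [_ f0 _] := df.
rewrite -!RintegralZr//; [|exact: iDl|exact: iD].
apply: le_Rintegral => //; [exact: integrableZr (iD _ mA)|
                            exact: integrableZr (iDl _ mA)|].
move=> p Ap; rewrite -!RintegralZl//; [|exact: iD|exact: iDl].
apply: le_Rintegral => //; [exact: integrableZl (iDl _ mB)|
                            exact: integrableZl (iD _ mB)|].
by move=> q Bq; apply: mlr_shift => //; exact: AB.
Qed.

Lemma window_shiftE (R : realType) (f : R -> R) (t z l : R) : prob_density f ->
  window f t (z + l) = \int[lebesgue_measure]_(x in `[z - t, z]) f (x + l).
Proof.
move=> df; rewrite /Rintegral; apply: EFin_inj; rewrite [RHS]fineK; last first.
  apply: integrable_fin_num => //.
  exact: (@integrable_density _ (fun x => f (x + l)) _ (prob_density_shift l df)).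
rewrite -[LHS]mul1e -(opprK l) -(integral_closed_window t z _ df)//.
rewrite [RHS]integral_mkcond; apply: eq_integral => x _.
rewrite patchE mem_setE in_itv/= !opprK.
by case: ifP => _; rewrite ?mul1e ?mul0e.
Qed.

(* The ranges of integration [x - t, x] and [y - t, y] are compared pointwise
   outside their overlap, where both products are the same. *)
Lemma window_mlr (R : realType) (f : R -> R) (t l x y : R) :
  prob_density f -> mlr f -> 0 <= l -> x <= y ->
  window f t x * window f t (y + l) <= window f t (x + l) * window f t y.
Proof.
move=> df mf l0 xy.
have dfl := prob_density_shift l df.
have W0 z : window f t z = \int[lebesgue_measure]_(x in `[z - t, z]) f x.
  rewrite -[in LHS](addr0 z) window_shiftE//.
  by apply: eq_Rintegral => u _; rewrite addr0.
rewrite !window_shiftE// !W0.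
have [xyt|yxt] := ltP x (y - t).
  apply: mlr_Rintegral => // p q /=; rewrite !in_itv/= => /andP[_ px] /andP[yq _].
  lra.
(* The flag [i] decides which piece receives the cut point, so that both windows are split with the
   same closed overlap [y - t, x]. *)
have split2 (g : R -> R) (a b c : R) (i : bool) : prob_density g -> a <= b -> b <= c ->
    \int[lebesgue_measure]_(u in `[a, c]) g u =
    \int[lebesgue_measure]_(u in [set` Interval (BLeft a) (BSide i b)]) g u +
    \int[lebesgue_measure]_(u in [set` Interval (BSide i b) (BRight c)]) g u.
  move=> dg ab bc.
  rewrite (@itv_bndbnd_setU _ _ _ (BSide i b)).
  - rewrite Rintegral_setU//.
    + exact: integrable_density (measurableU _ _ _ _).
    + apply/disj_setPS => u [/=]; case: (i); rewrite !in_itv/= =>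
        /andP[_ h1] /andP[h2 _].
        by move: h1; rewrite ltNge h2.
      by move: h2; rewrite ltNge h1.
  - by case: i; rewrite bnd_simp.
  - by case: i; rewrite bnd_simp.
have lx : x - t <= y - t by lra.
rewrite (split2 _ (x - t) (y - t) x true)// (split2 _ (y - t) x y false)//.
rewrite (split2 _ (x - t) (y - t) x true)// (split2 _ (y - t) x y false)//.
set L := [set` _]; set O := [set` _]; set M := [set` _].
have mL : measurable L by exact: measurable_itv.
have mO : measurable O by exact: measurable_itv.
have mM : measurable M by exact: measurable_itv.
have cross := mlr_Rintegral df mf l0.
have LO p q : L p -> O q -> p <= q.
  by rewrite /L /O/= !in_itv/= => /andP[_ ?] /andP[? _]; lra.
have LM p q : L p -> M q -> p <= q.
  by rewrite /L /M/= !in_itv/= => /andP[_ ?] /andP[? _]; lra.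
have OM p q : O p -> M q -> p <= q.
  by rewrite /O /M/= !in_itv/= => /andP[_ ?] /andP[? _]; lra.
have := cross _ _ mL mO LO; have := cross _ _ mL mM LM.
have := cross _ _ mO mM OM.
rewrite !mulrDl !mulrDr; lra.
Qed.

(** This is h_l(z) h_0(w) <= h_l(w) h_0(z) for w < z, with f W for h_0. The summands compare one by
    one: the first by the ratio of W, the second by that of f. *)
Lemma mixture_ratio_le (R : realType) (fz fw fzl fwl Wz Ww Wzl Wwl : R) :
  0 <= fz -> 0 <= fw -> 0 <= Wz -> 0 <= Ww ->
  fw * fzl <= fwl * fz -> Ww * Wzl <= Wwl * Wz ->
  (fz * Wzl + fzl * Wz) * (fw * Ww) <= (fw * Wwl + fwl * Ww) * (fz * Wz).
Proof.
move=> fz0 fw0 Wz0 Ww0 hf hW.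
have h1 := ler_wpM2l (mulr_ge0 fz0 fw0) hW.
have h2 := ler_wpM2l (mulr_ge0 Wz0 Ww0) hf.
lra.
Qed.

Lemma integral_gt0 (R : realType) (g : R -> R) (D : set R) (a b : R) :
  measurable_fun [set: R] g -> (forall x, 0 <= g x) -> measurable D ->
  a < b -> `[a, b]%classic `<=` D -> (forall x, a <= x <= b -> 0 < g x) ->
  (0 < \int[lebesgue_measure]_(x in D) (g x)%:E)%E.
Proof.
move=> mg g0 mD ab abD gpos.
rewrite lt_neqAle integral_ge0 ?andbT; last by move=> x _; rewrite lee_fin.
apply/eqP => /esym I0.
have mgE : measurable_fun D (EFin \o g).
  by apply/measurable_EFinP; exact: measurable_funS mg.
have : (\int[lebesgue_measure]_(x in D) `|(EFin \o g) x| = 0)%E.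
  by rewrite -I0; apply: eq_integral => x _; rewrite /= ger0_norm.
move/(ae_eq_integral_abs lebesgue_measure mD mgE) => [N [mN N0 sN]].
have : (lebesgue_measure `[a, b]%classic <= lebesgue_measure N)%E.
  apply: le_measure; rewrite ?inE//.
  apply: subset_trans sN => x xab /= /(_ (abD _ xab)) [] gx0.
  by have := gpos x xab; rewrite gx0 ltxx.
by rewrite N0 lebesgue_measure_itv/= lte_fin ab -EFinB lee_fin leNgt subr_gt0 ab.
Qed.

(** A shift by x - a trades the pair a, b for x and its mirror image: f(a) f(b) <= f(x) f(a + b -
    x). *)
Lemma mlr_support (R : realType) (f : R -> R) (a b x : R) :
  (forall y, 0 <= f y) -> mlr f -> 0 < f a -> 0 < f b -> a <= x <= b -> 0 < f x.
Proof.
move=> f0 mf fa fb /andP[ax xb].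
have := @mlr_shift _ f (x - a) a (a + b - x) mf.
rewrite subr_ge0 => /(_ ax); rewrite lerBrDr lerD2l => /(_ xb).
rewrite (_ : a + b - x + (x - a) = b); last by ring.
rewrite (_ : a + (x - a) = x); last by ring.
have := mulr_gt0 fa fb => p /(lt_le_trans p).
by case: (ltgtP (f x) 0) (f0 x) => // ->; rewrite mul0r ltxx.
Qed.

(** f is positive somewhere off every null set; this is applied to the empty set, then to the
    singleton of the first point found. *)
Lemma density_two_points (R : realType) (f : R -> R) : prob_density f ->
  exists a b, [/\ a < b, 0 < f a & 0 < f b].
Proof.
move=> [mf f0 f1].
have mfE : measurable_fun [set: R] (EFin \o f) by exact/measurable_EFinP.
have nz (N : set R) : measurable N -> lebesgue_measure N = 0%E ->
    exists2 x, ~ N x & 0 < f x.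
  move=> mN N0; apply: contrapT => nx.
  have : (\int[lebesgue_measure]_x (f x)%:E = 0)%E.
    rewrite -(integral0 lebesgue_measure [set: R]).
    apply: ge0_ae_eq_integral => //; first by move=> x _; rewrite lee_fin.
    exists N; split => // x /= fx; apply: contrapT => Nx; apply: fx => _.
    congr (_%:E); apply/eqP; rewrite eq_le f0 andbT leNgt; apply/negP => fx.
    by apply: nx; exists x.
  by rewrite f1 => /eqP; rewrite onee_eq0.
have [a _ fa] := nz set0 measurable0 (measure0 lebesgue_measure).
have [b ba fb] := nz [set a] (measurable_set1 a) (lebesgue_measure_set1 a).
have [ab|ba'|ab] := ltgtP a b; [by exists a, b|by exists b, a|].
by case: ba.
Qed.

Lemma window_mass_gt0 (R : realType) (f : R -> R) (t : R) :
  prob_density f -> mlr f -> 0 < t ->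
  (0 < \int[lebesgue_measure]_z (f z * window f t z)%:E)%E.
Proof.
move=> df mf t0; have [mfm f0 f1] := df.
have [a [b [ab fa fb]]] := density_two_points df.
have sup x : a <= x <= b -> 0 < f x by exact: mlr_support.
(* Staying right of the midpoint keeps z away from a, so [z - t, z] meets the support in length at
   least min(t, z - a) > 0. *)
apply: (@integral_gt0 _ (fun z => f z * window f t z) _ ((a + b) / 2) b) => //.
- by apply: measurable_funM => //; exact: measurable_window.
- by move=> x; rewrite mulr_ge0// window_ge0.
- by lra.
move=> x /andP[ax xb]; apply: mulr_gt0; first by apply: sup; apply/andP; split; lra.
rewrite -lte_fin windowE//.
have mt : 0 < Num.min t (x - a) by rewrite lt_min t0; lra.
apply: (@integral_gt0 _ (fun u => f (x - u)) _ 0 (Num.min t (x - a))) => //.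
- exact: measurable_reflect.
- by move=> u /=; rewrite !in_itv/= le_min => /andP[-> /andP[->]].
- move=> u; rewrite le_min => /andP[u0 /andP[_ ua]]; apply: sup.
  by apply/andP; split; lra.
Qed.

(* Since h1 / h0 is nonincreasing, its infimum over {w < c} separates its values
   on the two sides of c; taking an infimum avoids evaluating at c, where h0
   may vanish. *)
Lemma ratio_pivot (R : realType) (h0 h1 : R -> R) (c : R) :
  measurable_fun [set: R] h0 -> measurable_fun [set: R] h1 ->
  (forall z, 0 <= h0 z) -> (forall z, 0 <= h1 z) ->
  (forall w z, w < z -> h1 z * h0 w <= h1 w * h0 z) ->
  (0 < \int[lebesgue_measure]_z (h0 z)%:E)%E ->
  (\int[lebesgue_measure]_z ((Num.max (z - c) 0)%:E * (h0 z)%:E) <=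
   \int[lebesgue_measure]_z ((Num.max (c - z) 0)%:E * (h0 z)%:E))%E ->
  (\int[lebesgue_measure]_z ((Num.max (z - c) 0)%:E * (h1 z)%:E) <=
   \int[lebesgue_measure]_z ((Num.max (c - z) 0)%:E * (h1 z)%:E))%E.
Proof.
move=> mh0 mh1 h00 h10 hr Ih0 I0.
have mp : measurable_fun [set: R] (fun z => (Num.max (z - c) 0)%:E).
  apply/measurable_EFinP; apply: measurable_maxr => //; exact: measurable_funB.
have mn : measurable_fun [set: R] (fun z => (Num.max (c - z) 0)%:E).
  apply/measurable_EFinP; apply: measurable_maxr => //; exact: measurable_funB.
have mh0E : measurable_fun [set: R] (fun z => (h0 z)%:E) by exact/measurable_EFinP.
have mh1E : measurable_fun [set: R] (fun z => (h1 z)%:E) by exact/measurable_EFinP.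
have p0 (x y : R) : 0 <= y -> (0 <= (Num.max x 0)%:E * y%:E)%E.
  by move=> y0; rewrite mule_ge0 ?lee_fin// le_max lexx orbT.
(* If h0 vanished below c, the balance would force it to vanish almost everywhere above c too,
   against its positive mass. *)
have [w0 w0c h0w0] : exists2 w, w < c & 0 < h0 w.
  apply: contrapT => nw.
  have h0z z : z < c -> h0 z = 0.
    move=> zc; apply/eqP; rewrite eq_le h00 andbT leNgt; apply/negP => hz.
    by apply: nw; exists z.
  have Ip0 : (\int[lebesgue_measure]_z ((Num.max (z - c) 0)%:E * (h0 z)%:E) = 0)%E.
    apply/eqP; rewrite eq_le integral_ge0 ?andbT; last by move=> z _; exact: p0.
    rewrite (le_trans I0)//; rewrite integral0_eq// => z _.
    have [zc|cz] := ltP z c; first by rewrite h0z// mule0.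
    by rewrite max_r ?mul0e// subr_le0.
  suff I00 : (\int[lebesgue_measure]_z (h0 z)%:E = 0)%E by rewrite I00 ltxx in Ih0.
  rewrite -(integral0 lebesgue_measure [set: R]).
  apply: ge0_ae_eq_integral => //; first by move=> x _; rewrite lee_fin.
  have /(ae_eq_integral_abs lebesgue_measure measurableT) :
    (\int[lebesgue_measure]_z `|(Num.max (z - c) 0)%:E * (h0 z)%:E| = 0)%E.
    rewrite -[RHS]Ip0; apply: eq_integral => z _.
    by rewrite gee0_abs// p0.
  move=> /(_ (emeasurable_funM mp mh0E)) [N [mN N0 sN]].
  exists (N `|` [set c]); split.
  - exact: measurableU.
  - by apply: null_set_setU => //; exact: lebesgue_measure_set1.
  move=> z /= hz; have [zc|cz|->] := ltgtP z c; last by right.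
    by exfalso; apply: hz => _; rewrite h0z.
  left; apply: sN => /= zz; apply: hz => _.
  have /eqP := zz I.
  rewrite -EFinM eqe mulf_eq0 max_l ?subr_ge0 ?ltW// subr_eq0 gt_eqF//=.
  by move/eqP ->.
pose S := [set h1 w / h0 w | w in [set w | w < c /\ 0 < h0 w]].
have S0 : S !=set0 by exists (h1 w0 / h0 w0), w0.
have Slb : lbound S 0.
  by move=> _ [w [_ _] <-]; rewrite divr_ge0.
pose k := inf S.
have k0 : 0 <= k by exact: lb_le_inf.
have below z : z < c -> k * h0 z <= h1 z.
  move=> zc; have [hz|hz] := leP (h0 z) 0.
    by rewrite (le_trans _ (h10 z))// mulr_ge0_le0.
  by rewrite -ler_pdivlMr//; apply: ge_inf; [exists 0|exists z].
have above z : c < z -> h1 z <= k * h0 z.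
  move=> cz; have [hz|hz] := leP (h0 z) 0.
    (* Where h0 vanishes above c, comparison with [w0] forces h1 to vanish as well. *)
    have hz0 : h0 z = 0 by apply/eqP; rewrite eq_le hz h00.
    have := hr w0 z (lt_trans w0c cz).
    by rewrite hz0 mulr0 mulr0 pmulr_lle0.
  rewrite -ler_pdivrMr//; apply: lb_le_inf => // _ [w [wc hw] <-].
  by rewrite ler_pdivrMr// mulrAC ler_pdivlMr// hr// (lt_trans wc).
(* The bounds h1 <= k h0 above c and k h0 <= h1 below c sandwich the balance of h0 scaled by k. *)
have step1 : (\int[lebesgue_measure]_z ((Num.max (z - c) 0)%:E * (h1 z)%:E) <=
    k%:E * \int[lebesgue_measure]_z ((Num.max (z - c) 0)%:E * (h0 z)%:E))%E.
  rewrite -ge0_integralZl//; [|exact: emeasurable_funM|by move=> z _; exact: p0].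
  apply: ge0_le_integral => //; [by move=> z _; exact: p0|exact: emeasurable_funM| |].
    by apply: measurable_funeM; exact: emeasurable_funM.
  move=> z _; rewrite muleCA; have [cz|zc] := ltP c z.
    by apply: lee_wpmul2l; rewrite ?lee_fin ?le_max ?lexx ?orbT// above.
  by rewrite max_r ?mul0e// subr_le0.
have step2 : (k%:E * \int[lebesgue_measure]_z ((Num.max (c - z) 0)%:E * (h0 z)%:E)
    <= \int[lebesgue_measure]_z ((Num.max (c - z) 0)%:E * (h1 z)%:E))%E.
  rewrite -ge0_integralZl//; [|exact: emeasurable_funM|by move=> z _; exact: p0].
  apply: ge0_le_integral => //.
  - by move=> z _; rewrite mule_ge0// p0.
  - by apply: measurable_funeM; exact: emeasurable_funM.
  - exact: emeasurable_funM.
  move=> z _; rewrite muleCA; have [zc|cz] := ltP z c.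
    by apply: lee_wpmul2l; rewrite ?lee_fin ?le_max ?lexx ?orbT// below.
  by rewrite max_r ?mul0e// subr_le0.
apply: (le_trans step1); apply: le_trans step2.
by apply: lee_wpmul2l => //; rewrite lee_fin.
Qed.

(** * Balance of the deviations of the maximum *)

Lemma maxr_sub (R : realType) (x : R) : Num.max x 0 - Num.max (- x) 0 = x.
Proof.
case: (leP x 0) => hx; case: (leP (- x) 0) => hx'; lra.
Qed.

(** The two parts differ by the integral of (z - c) f W, which is nonpositive exactly when the mean
    is at most c. The finite second moment makes the real-valued integrals in [phi_bound] genuine
    and not default values. *)
Lemma phi_bound_balance (R : realType) (f : R -> R) (t b c : R) :
  prob_density f -> mlr f -> 0 < t ->
  (\int[lebesgue_measure]_z
     (((z - b) ^+ 2)%:E * (f z * window f t z)%R%:E) < +oo)%E ->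
  phi_bound f t <= c ->
  (\int[lebesgue_measure]_z ((Num.max (z - c) 0)%:E * (f z * window f t z)%:E) <=
   \int[lebesgue_measure]_z ((Num.max (c - z) 0)%:E * (f z * window f t z)%:E))%E.
Proof.
move=> df mlrf t0 fin bc; have [mf f0 f1] := df.
set g := fun z => f z * window f t z.
have mg : measurable_fun [set: R] g.
  by apply: measurable_funM => //; exact: measurable_window.
have g0 z : 0 <= g z by rewrite /g mulr_ge0// window_ge0.
have ig : lebesgue_measure.-integrable [set: R] (EFin \o g).
  apply: le_integrable (integrable_density df measurableT) => //.
    exact/measurable_EFinP.
  move=> z _; rewrite /= lee_fin !ger0_norm//.
  by rewrite /g ler_piMr// window_le1.
have mz2 : measurable_fun [set: R] (fun z => (z - b) ^+ 2).
  by apply: measurable_funX; exact: measurable_funB.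
have iz2 : lebesgue_measure.-integrable [set: R]
    (EFin \o (fun z => (z - b) ^+ 2 * g z)).
  apply/integrableP; split; first by apply/measurable_EFinP; exact: measurable_funM.
  move: fin; congr (_ < _)%E; apply: eq_integral => z _.
  by rewrite /= ger0_norm// mulr_ge0// sqr_ge0.
have iz (q : R -> R) (k : R) : measurable_fun [set: R] q ->
    (forall z, `|q z| <= (z - b) ^+ 2 + k) ->
    lebesgue_measure.-integrable [set: R] (EFin \o (fun z => q z * g z)).
  move=> mq qk.
  have ikg : lebesgue_measure.-integrable [set: R] (EFin \o (fun z => k * g z)).
    exact: integrableZl ig.
  apply: le_integrable (integrableD measurableT iz2 ikg) => //.
    by apply/measurable_EFinP; exact: measurable_funM.
  move=> z _; rewrite /= lee_fin normrM (ger0_norm (g0 z)) -mulrDl.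
  by apply: le_trans (ler_norm _); rewrite ler_wpM2r.
(* From |y| <= y^2 + 1 at y = z - b, a consequence of (|y| - 1)^2 >= 0. *)
have absz z : `|z| <= (z - b) ^+ 2 + (1 + `|b|).
  have h : `|z - b| <= (z - b) ^+ 2 + 1.
    rewrite -real_normK ?num_real//; have := sqr_ge0 (`|z - b| - 1); nra.
  have := ler_normD (z - b) b; rewrite subrK; lra.
have iid := iz id _ (@measurable_id _ _ _) absz.
have D0 := window_mass_gt0 df mlrf t0.
have D0E : ((\int[lebesgue_measure]_z g z)%:E = \int[lebesgue_measure]_z (g z)%:E)%E.
  by rewrite /Rintegral fineK//; exact: integrable_fin_num.
have iW z D : measurable D ->
    lebesgue_measure.-integrable D (EFin \o (fun u => f (z - u))).
  exact: integrable_density (prob_density_reflect z df).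
have numE : \int[lebesgue_measure]_z
    \int[lebesgue_measure]_(u in `[0, t]) (z * f (z - u) * f z) =
    \int[lebesgue_measure]_z (z * g z).
  apply: eq_Rintegral => z _; rewrite RintegralZr//; last first.
    exact: integrableZl (iW z _ _).
  by rewrite RintegralZl//; [rewrite -mulrA [X in z * X]mulrC|exact: iW].
have denE : \int[lebesgue_measure]_z
    \int[lebesgue_measure]_(u in `[0, t]) (f (z - u) * f z) =
    \int[lebesgue_measure]_z g z.
  apply: eq_Rintegral => z _; rewrite RintegralZr//; last exact: iW.
  by rewrite mulrC.
have D0R : 0 < \int[lebesgue_measure]_z g z by rewrite -lte_fin D0E.
move: bc; rewrite /phi_bound numE denE ler_pdivrMr// => bc.
have ip : lebesgue_measure.-integrable [set: R]
    (EFin \o (fun z => Num.max (z - c) 0 * g z)).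
  apply: (@iz (fun z => Num.max (z - c) 0) (1 + `|b| + `|c|)).
    by apply: measurable_maxr => //; exact: measurable_funB.
  move=> z; rewrite ger0_norm ?le_max ?lexx ?orbT// addrA.
  apply: (@le_trans _ _ (`|z| + `|c|)); last by rewrite lerD2r.
  by rewrite ge_max (le_trans (ler_norm _) (ler_normB _ _)) addr_ge0.
have im : lebesgue_measure.-integrable [set: R]
    (EFin \o (fun z => Num.max (c - z) 0 * g z)).
  apply: (@iz (fun z => Num.max (c - z) 0) (1 + `|b| + `|c|)).
    by apply: measurable_maxr => //; exact: measurable_funB.
  move=> z; rewrite ger0_norm ?le_max ?lexx ?orbT// addrA.
  apply: (@le_trans _ _ (`|z| + `|c|)); last by rewrite lerD2r.
  by rewrite ge_max [leRHS]addrC (le_trans (ler_norm _) (ler_normB _ _)) addr_ge0.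
have diff : \int[lebesgue_measure]_z (Num.max (z - c) 0 * g z) -
    \int[lebesgue_measure]_z (Num.max (c - z) 0 * g z) =
    \int[lebesgue_measure]_z (z * g z) - c * \int[lebesgue_measure]_z g z.
  rewrite -RintegralZl// -!RintegralB//; last exact: integrableZl ig.
  apply: eq_Rintegral => z _; rewrite -!mulrBl -[in RHS](maxr_sub (z - c)).
  by rewrite opprB.
have : \int[lebesgue_measure]_z (Num.max (z - c) 0 * g z) <=
    \int[lebesgue_measure]_z (Num.max (c - z) 0 * g z)
  by rewrite -subr_le0 diff subr_le0.
by rewrite -lee_fin /Rintegral !fineK//; exact: integrable_fin_num.
Qed.

(** [phi] is monotone only on the half-line; composing it with max(0, .) gives a function monotone
    everywhere. *)
Lemma measurable_nondecreasing_nonneg d (T : measurableType d) (R : realType)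
    (phi : R -> R) (U : T -> R) :
  (forall u v, 0 <= u -> u <= v -> phi u <= phi v) ->
  measurable_fun setT U -> (forall w, 0 <= U w) ->
  measurable_fun setT (fun w => phi (U w)).
Proof.
move=> phi_nd mU U0.
have -> : (fun w => phi (U w)) = (phi \o Num.max 0) \o U.
  by apply/funext => w /=; rewrite max_r.
apply: measurableT_comp => //; apply: nondecreasing_measurable => // u v uv /=.
apply: phi_nd; first by rewrite le_max lexx.
by rewrite ge_max !le_max lexx uv orbT.
Qed.

(** Passes from the events {U <= t} to the level sets of phi(U). The point M, where [phi] has
    reached s, bounds {u | phi(u) < s}, whose supremum is the t sought. *)
Lemma level_set_balance d (T : measurableType d) (R : realType)
    (P : {measure set T -> \bar R}) (U : T -> R) (p n : T -> \bar R)
    (phi : R -> R) (s M : R) :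
  measurable_fun setT U -> measurable_fun setT p -> measurable_fun setT n ->
  (forall w, 0 <= U w) -> (forall w, 0 <= p w)%E -> (forall w, 0 <= n w)%E ->
  (forall u v, 0 <= u -> u <= v -> phi u <= phi v) -> 0 <= M -> s <= phi M ->
  (forall t, 0 <= t -> phi t < s ->
    (\int[P]_w (if (U w <= t)%R then p w else 0) <=
     \int[P]_w (if (U w <= t)%R then n w else 0))%E) ->
  (\int[P]_w (if (phi (U w) < s)%R then p w else 0) <=
   \int[P]_w (if (phi (U w) < s)%R then n w else 0))%E.
Proof.
move=> mU mp mn U0 p0 n0 phi_nd M0 sM H.
have mphi : measurable_fun setT (fun w => phi (U w)).
  exact: measurable_nondecreasing_nonneg.
have [[u0 u00 phiu0]|J0] := pselect (exists2 u, 0 <= u & phi u < s); last first.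
  rewrite !integral0_eq// => w _; case: ifP => // h;
    by exfalso; apply: J0; exists (U w).
pose J := [set u | 0 <= u /\ phi u < s].
have JM : ubound J M.
  move=> u [u_ge0 us]; rewrite leNgt; apply/negP => /ltW Mu.
  by have := le_lt_trans (le_trans sM (phi_nd _ _ M0 Mu)) us; rewrite ltxx.
have supJ : has_sup J by split; [exists u0|exists M].
pose t := sup J.
have Jt u : 0 <= u -> phi u < s -> u <= t.
  by move=> ? ?; apply: ub_le_sup => //; exists M.
have t0 : 0 <= t by apply: le_trans (Jt _ u00 phiu0).
have [phits|sphit] := ltP (phi t) s.
  suff E w : (phi (U w) < s) = (U w <= t).
    by under eq_integral do rewrite E; under [leRHS]eq_integral do rewrite E; exact: H.
  apply/idP/idP => h; first exact: Jt.
  exact: le_lt_trans (phi_nd _ _ _ h) phits.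
(* Here the level set is {U < t}, to be exhausted by events {U <= t'} with t' < t. *)
have {}t0 : 0 < t.
  rewrite lt_neqAle t0 andbT; apply/eqP => t00.
  have := Jt _ u00 phiu0; rewrite -t00 => u0le.
  have u0E : u0 = 0 by apply/eqP; rewrite eq_le u0le.
  by move: sphit; rewrite -t00 -u0E leNgt phiu0.
(* These points start at 0 and increase to t, so they stay where [phi] is known to be monotone. *)
pose tn (k : nat) := t - t / k.+1%:R.
have tn_ge0 k : 0 <= tn k.
  by rewrite /tn subr_ge0 ler_pdivrMr// ler_peMr ?ler1n// ltW.
have phi_tn k : phi (tn k) < s.
  have e0 : 0 < t / k.+1%:R by rewrite divr_gt0.
  have [u [uge0 us] tnu] := sup_adherent e0 supJ.
  exact: le_lt_trans (phi_nd _ _ (tn_ge0 k) (ltW tnu)) us.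
pose F k := [set w | U w <= tn k].
have mF k : measurable (F k).
  by rewrite /F -[X in measurable X]setTI; exact: measurable_fun_le.
have ndF : nondecreasing_seq F.
  move=> i j ij; apply/subsetPset => w; rewrite /F/= => /le_trans; apply.
  rewrite /tn lerD2l lerN2 ler_pM2l// lef_pV2 ?posrE//.
  by rewrite ler_nat.
have UF : [set w | phi (U w) < s] = \bigcup_k F k.
  apply/seteqP; split=> w /=; last first.
    move=> [k _ /= h]; exact: le_lt_trans (phi_nd _ _ _ h) (phi_tn k).
  move=> h; have Ut : U w < t.
    rewrite lt_neqAle Jt// andbT; apply/eqP => E.
    by move: sphit; rewrite -E leNgt h.
  (* Chosen so that t / (k + 1) <= t - U w. *)
  pose k := Num.truncn (t / (t - U w)).
  exists k => //; rewrite /F/= /tn lerBrDr -lerBrDl ler_pdivrMr//.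
  rewrite mulrC -ler_pdivrMr ?subr_gt0//.
  by rewrite ltW// truncnS_gt.
have ifE (q : T -> \bar R) (A : set T) (c : T -> bool) : (forall w, A w <-> c w) ->
    (\int[P]_w (if c w then q w else 0) = \int[P]_(w in A) q w)%E.
  move=> Ac; rewrite [RHS]integral_mkcond; apply: eq_integral => w _.
  rewrite patchE; case: ifPn => [/Ac|/negP h]; first by move/mem_set => ->.
  by rewrite memNset// => /Ac.
rewrite !(ifE _ (\bigcup_k F k)); try by move=> w; rewrite -UF.
(* Only the side of p passes to the limit; at each k the side of n is bounded by its integral over
   the union. *)
have cv := @ge0_nondecreasing_set_cvg_integral _ _ _ F p P ndF mF
  (fun i => measurable_funS measurableT (@subsetT _ _) mp) (fun i x _ => p0 x).
rewrite -(cvg_lim _ cv)//; apply: lime_le; first by apply/cvg_ex; eexists; exact: cv.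
apply: nearW => k; rewrite -(ifE p (F k) (fun w => U w <= tn k))//.
apply: (le_trans (H _ (tn_ge0 k) (phi_tn k))).
rewrite (ifE n (F k))//; apply: ge0_subset_integral => //.
- exact: bigcupT_measurable.
- exact: measurable_funS mn.
- exact: bigcup_sup.
Qed.

(** * Layer cake *)

Lemma integral_pos_part (R : realType) (a b z : R) : a <= b ->
  (\int[lebesgue_measure]_s
     (if (a < s < b)%R then (Num.max (s - z) 0)%:E else 0) =
   ((Num.max (b - z) 0 ^+ 2 - Num.max (a - z) 0 ^+ 2) / 2)%:E)%E.
Proof.
move=> ab; have [bz|zb] := leP b z.
  rewrite integral0_eq => [|s _].
    by rewrite !max_r ?subr_le0 ?(le_trans ab)// subrr mul0r.
  case: ifP => // /andP[_ sb]; rewrite max_r// subr_le0.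
  exact: le_trans (ltW sb) bz.
(* The integrand is zero up to z, so integration effectively starts at a'. *)
pose a' := Num.max a z.
have a'z : z <= a' by rewrite le_max lexx orbT.
have -> : Num.max (a - z) 0 = a' - z by rewrite /a' addr_maxl subrr.
rewrite max_l ?subr_ge0 ?(ltW zb)//.
have : a' <= b by rewrite ge_max ab ltW.
rewrite le_eqVlt => /predU1P[a'b|a'b].
  rewrite a'b subrr mul0r; apply: integral0_eq => s _; case: ifP => // /andP[as_ sb].
  suff -> : Num.max (s - z) 0 = 0 by [].
  rewrite max_r// subr_le0.
  by move: sb; rewrite -a'b /a' lt_max => /orP[|/ltW//]; rewrite ltNge ltW.
pose F : R -> R := 2^-1 *: (id - cst z) ^+ 2.
have FE s : F s = 2^-1 * (s - z) ^+ 2 by [].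
have dF (x : R) : is_derive x 1 F (x - z).
  apply: is_derive_eq.
  by rewrite /= !fctE expr1 subr0 /GRing.scale/= mulr1 mulKf// pnatr_eq0.
have cF (x : R) : {for x, continuous F}.
  by apply/differentiable_continuous; rewrite -derivable1_diffP.
have ms : measurable_fun [set: R] (fun s => (s - z)%:E).
  by apply/measurable_EFinP; exact: measurable_funB.
transitivity (\int[lebesgue_measure]_(s in `]a', b[) (s - z)%:E)%E.
  rewrite [RHS]integral_mkcond; apply: eq_integral => s _.
  rewrite patchE mem_setE in_itv/= gt_max.
  have [zs|sz] := ltP z s; first by rewrite andbT max_l// subr_ge0 ltW.
  by rewrite andbF/= max_r ?subr_le0// if_same.
rewrite -(@integral_itv_bndoo _ _ _ _ true false); last exact: measurable_funS ms.
rewrite (@continuous_FTC2 R (fun s => s - z) F a' b a'b).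
- by rewrite !FE -EFinB; congr (_%:E); field.
- apply: continuous_subspaceT => x.
  by apply: cvgB; [exact: cvg_id|exact: cvg_cst].
- split.
  + by move=> x _; exact: ex_derive.
  + by apply: cvg_at_right_filter; exact: cF.
  + by apply: cvg_at_left_filter; exact: cF.
- by move=> x _; rewrite derive1E derive_val.
Qed.

Lemma integral_neg_part (R : realType) (a b z : R) : a <= b ->
  (\int[lebesgue_measure]_s
     (if (a < s < b)%R then (Num.max (z - s) 0)%:E else 0) =
   ((Num.max (z - a) 0 ^+ 2 - Num.max (z - b) 0 ^+ 2) / 2)%:E)%E.
Proof.
move=> ab; rewrite -(@ge0_integral_reflect _ 0); last 2 first.
- apply: measurable_fun_ifT => //.
    by apply: measurable_and; exact: measurable_fun_ltr.
  apply/measurable_EFinP; apply: measurable_maxr => //; exact: measurable_funB.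
- by move=> s; case: ifP => // _; rewrite lee_fin le_max lexx orbT.
have := @integral_pos_part _ (- b) (- a) (- z); rewrite lerN2 => /(_ ab).
rewrite (_ : - a - - z = z - a) 1?(_ : - b - - z = z - b); [|ring..].
move=> <-; apply: eq_integral => s _.
rewrite sub0r ltrNl ltrNr andbC; case: ifP => // _.
by congr (Num.max _ _)%:E; ring.
Qed.

(* Layer cake for [(z - x)^2 - (z - b)^2], with the signed integrand
   [2 (s - z)] split into its positive and negative parts. *)
Lemma square_layer_cake (R : realType) (x b z : R) : x <= b ->
  (((z - x) ^+ 2)%:E + 2%:E * \int[lebesgue_measure]_s
     (if (x < s < b)%R then (Num.max (s - z) 0)%:E else 0) =
   ((z - b) ^+ 2)%:E + 2%:E * \int[lebesgue_measure]_s
     (if (x < s < b)%R then (Num.max (z - s) 0)%:E else 0))%E.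
Proof.
move=> xb; rewrite integral_pos_part// integral_neg_part//.
rewrite -!EFinM -!EFinD; congr (_%:E).
have sq (y : R) : y ^+ 2 = Num.max y 0 ^+ 2 + Num.max (- y) 0 ^+ 2.
  have [hy|hy] := leP y 0.
    by rewrite max_l ?oppr_ge0// sqrrN expr0n add0r.
  by rewrite max_r ?oppr_le0 ?ltW// expr0n addr0.
rewrite [(z - x) ^+ 2]sq [(z - b) ^+ 2]sq !opprB.
lra.
Qed.

(** Dominates the positive layers by the loss of the constant estimator, so that their expectation
    is finite and can be cancelled. *)
Lemma layer_le_square (R : realType) (x b z : R) : x <= b ->
  (2%:E * \int[lebesgue_measure]_s
     (if (x < s < b)%R then (Num.max (s - z) 0)%:E else 0) <=
   ((z - b) ^+ 2)%:E)%E.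
Proof.
move=> xb; rewrite integral_pos_part// -EFinM lee_fin mulrC divfK//.
have : 0 <= Num.max (x - z) 0 ^+ 2 by exact: sqr_ge0.
have : Num.max (b - z) 0 ^+ 2 <= (z - b) ^+ 2.
  by case: (leP (b - z) 0) => _; [rewrite expr0n sqr_ge0|rewrite -sqrrN opprB].
lra.
Qed.

(** * Comparison of the risks *)

Lemma window0 (R : realType) (f : R -> R) (z : R) : window f 0 z = 0.
Proof. by rewrite /window set_itv1 Rintegral_set1. Qed.

Lemma range_balance d (T : measurableType d) (R : realType)
    (P : probability T R) (X Y : {mfun T >-> R}) (f : R -> R) (a b t s : R) :
  prob_density f -> mlr f ->
  has_density P X (fun x => f (x - a)) -> has_density P Y (fun x => f (x - b)) ->
  independent_RVs P X Y -> a <= b -> 0 <= t ->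
  (0 < t ->
   (\int[lebesgue_measure]_z ((Num.max (z - s) 0)%:E * (f z * window f t z)%:E) <=
    \int[lebesgue_measure]_z ((Num.max (s - z) 0)%:E * (f z * window f t z)%:E))%E) ->
  (\int[P]_w (if (Num.max (X w) (Y w) - Num.min (X w) (Y w) <= t)%R
      then (Num.max (Num.max (X w) (Y w) - b - s) 0)%:E else 0) <=
   \int[P]_w (if (Num.max (X w) (Y w) - Num.min (X w) (Y w) <= t)%R
      then (Num.max (s - (Num.max (X w) (Y w) - b)) 0)%:E else 0))%E.
Proof.
move=> df mlrf dX dY iXY ab; have [mf f0 _] := df.
have mp : measurable_fun [set: R] (fun z => (Num.max (z - s) 0)%:E).
  by apply/measurable_EFinP; apply: measurable_maxr => //; exact: measurable_funB.
have mn : measurable_fun [set: R] (fun z => (Num.max (s - z) 0)%:E).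
  by apply/measurable_EFinP; apply: measurable_maxr => //; exact: measurable_funB.
have m0 (x : R) : (0 <= (Num.max x 0)%:E)%E by rewrite lee_fin le_max lexx orbT.
rewrite (expectation_max_range t df dX dY iXY mp)//.
rewrite (expectation_max_range t df dX dY iXY mn)//.
have mw := measurable_window t df.
have w0 z := window_ge0 t z df.
(* At t = 0, where (iii) gives no bound, the window is a point and both sides vanish. *)
rewrite le_eqVlt => /predU1P[<- _|t0 /(_ t0) bal].
  rewrite !integral0_eq// => z _; by rewrite !window0 !mulr0 addr0 mule0.
apply: (ratio_pivot (h0 := fun z => f z * window f t z)) => //.
- exact: measurable_funM.
- apply: measurable_funD; apply: measurable_funM => //.
    exact: measurable_shift.
  exact: measurable_shift.
- by move=> z; rewrite mulr_ge0.
- by move=> z; rewrite addr_ge0// mulr_ge0.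
- move=> w z wz; have l0 : 0 <= b - a by rewrite subr_ge0.
  apply: mixture_ratio_le => //.
    by apply: mlr_shift => //; exact: ltW.
  by apply: window_mlr => //; exact: ltW.
- exact: window_mass_gt0.
Qed.

Lemma risk_le d (T : measurableType d) (R : realType)
    (P : probability T R) (X Y : {mfun T >-> R}) (f phi : R -> R) (a b c : R) :
  prob_density f -> mlr f ->
  has_density P X (fun x => f (x - a)) -> has_density P Y (fun x => f (x - b)) ->
  independent_RVs P X Y -> a <= b ->
  (forall u v, 0 <= u -> u <= v -> phi u <= phi v) ->
  (forall u, 0 <= u -> phi u <= c) ->
  (forall s, s < c -> exists2 M, 0 <= M & s <= phi M) ->
  (forall t s, 0 < t -> phi t < s ->
   (\int[lebesgue_measure]_z ((Num.max (z - s) 0)%:E * (f z * window f t z)%:E) <=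
    \int[lebesgue_measure]_z ((Num.max (s - z) 0)%:E * (f z * window f t z)%:E))%E) ->
  (\int[P]_w ((delta_phi phi (X w, Y w) - b) ^+ 2)%:E <=
   \int[P]_w ((delta_const c (X w, Y w) - b) ^+ 2)%:E)%E.
Proof.
move=> df mlrf dX dY iXY ab phi_nd phi_le phi_ge bal.
pose Z w := Num.max (X w) (Y w) - b.
pose U w := Num.max (X w) (Y w) - Num.min (X w) (Y w).
pose V w := phi (U w).
have mmax : measurable_fun setT (fun w => Num.max (X w) (Y w)).
  exact: measurable_maxr.
have mU : measurable_fun setT U.
  by apply: measurable_funB => //; exact: measurable_minr.
have mZ : measurable_fun setT Z by exact: measurable_funB.
have U0 w : 0 <= U w by rewrite subr_ge0 ge_min le_max lexx.
have mV : measurable_fun setT V by exact: measurable_nondecreasing_nonneg.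
have Vc w : V w <= c by exact: phi_le.
pose p (w : T) (s : R) : \bar R :=
  if V w < s < c then (Num.max (Z w - s) 0)%:E else 0%E.
pose n (w : T) (s : R) : \bar R :=
  if V w < s < c then (Num.max (s - Z w) 0)%:E else 0%E.
have m0 (x : R) : (0 <= (Num.max x 0)%:E)%E by rewrite lee_fin le_max lexx orbT.
have p0 w s : (0 <= p w s)%E by rewrite /p; case: ifP.
have n0 w s : (0 <= n w s)%E by rewrite /n; case: ifP.
have mT1 (g : T -> R) : measurable_fun [set: T] g ->
    measurable_fun [set: T * measurableTypeR R] (fun z => (g z.1 : R)).
  by move=> mg; exact: measurableT_comp mg measurable_fst.
have mT2 : measurable_fun [set: T * measurableTypeR R] (fun z => (z.2 : R)).
  exact: measurable_snd.
have mc : measurable_fun [set: T * measurableTypeR R]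
    (fun z => V z.1 < (z.2 : R) < c).
  by apply: measurable_and; apply: measurable_fun_ltr => //; exact: mT1.
have mp : measurable_fun [set: T * measurableTypeR R] (fun z => p z.1 z.2).
  apply: measurable_fun_ifT => //; apply/measurable_EFinP.
  by apply: measurable_maxr => //; apply: measurable_funB => //; exact: mT1.
have mn : measurable_fun [set: T * measurableTypeR R] (fun z => n z.1 z.2).
  apply: measurable_fun_ifT => //; apply/measurable_EFinP.
  by apply: measurable_maxr => //; apply: measurable_funB => //; exact: mT1.
have pn : (\int[P]_w \int[lebesgue_measure]_s p w s <=
           \int[P]_w \int[lebesgue_measure]_s n w s)%E.
  rewrite (fubini_tonelli (m1 := P) (m2 := lebesgue_measure)
    (fun z : T * measurableTypeR R => p z.1 z.2))//.
  rewrite (fubini_tonelli (m1 := P) (m2 := lebesgue_measure)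
    (fun z : T * measurableTypeR R => n z.1 z.2))//.
  apply: ge0_le_integral => //.
  - by move=> s _; apply: integral_ge0.
  - exact: (measurable_fun_fubini_tonelli_G
      (fun z : T * measurableTypeR R => p z.1 z.2)).
  - exact: (measurable_fun_fubini_tonelli_G
      (fun z : T * measurableTypeR R => n z.1 z.2)).
  (* Layers at or above c are empty; below c, the layer at s lives on {phi(U) < s}. *)
  move=> s _; have [sc|cs] := ltP s c; last first.
    by rewrite !integral0_eq// => w _; rewrite /n /p [s < c]ltNge cs andbF.
  have [M M0 sM] := phi_ge s sc.
  have pE w : p w s = if phi (U w) < s then (Num.max (Z w - s) 0)%:E else 0%E.
    by rewrite /p sc andbT.
  have nE w : n w s = if phi (U w) < s then (Num.max (s - Z w) 0)%:E else 0%E.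
    by rewrite /n sc andbT.
  under eq_integral do rewrite pE; under [leRHS]eq_integral do rewrite nE.
  apply: (@level_set_balance _ _ _ P U (fun w => (Num.max (Z w - s) 0)%:E)
    (fun w => (Num.max (s - Z w) 0)%:E) phi s M) => //.
  - apply/measurable_EFinP; apply: measurable_maxr => //; exact: measurable_funB.
  - apply/measurable_EFinP; apply: measurable_maxr => //; exact: measurable_funB.
  move=> t t0 phits; apply: (range_balance df mlrf dX dY iXY ab t0) => {}t0.
  exact: bal.
have mIp : measurable_fun setT (fun w => \int[lebesgue_measure]_s p w s)%E.
  exact: (measurable_fun_fubini_tonelli_F
    (fun z : T * measurableTypeR R => p z.1 z.2)).
have mIn : measurable_fun setT (fun w => \int[lebesgue_measure]_s n w s)%E.
  exact: (measurable_fun_fubini_tonelli_F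
    (fun z : T * measurableTypeR R => n z.1 z.2)).
have Ip0 w : (0 <= \int[lebesgue_measure]_s p w s)%E by apply: integral_ge0.
have In0 w : (0 <= \int[lebesgue_measure]_s n w s)%E by apply: integral_ge0.
have m2 (g : T -> R) : measurable_fun setT g ->
    measurable_fun setT (fun w => ((Z w - g w) ^+ 2)%:E).
  move=> mg; apply/measurable_EFinP; apply: measurable_funX.
  exact: measurable_funB.
have sq0 (x : R) : (0 <= (x ^+ 2)%:E)%E by rewrite lee_fin sqr_ge0.
have -> : (\int[P]_w ((delta_phi phi (X w, Y w) - b) ^+ 2)%:E =
    \int[P]_w ((Z w - V w) ^+ 2)%:E)%E.
  apply: eq_integral => w _; rewrite /delta_phi /Z /V /U /=.
  by congr ((_ ^+ 2)%:E); ring.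
have -> : (\int[P]_w ((delta_const c (X w, Y w) - b) ^+ 2)%:E =
    \int[P]_w ((Z w - c) ^+ 2)%:E)%E.
  apply: eq_integral => w _; rewrite /delta_const /Z /=.
  by congr ((_ ^+ 2)%:E); ring.
have mc2 : measurable_fun setT (fun w => ((Z w - c) ^+ 2)%:E) by exact: m2.
have mV2 : measurable_fun setT (fun w => ((Z w - V w) ^+ 2)%:E) by exact: m2.
have M2p : measurable_fun setT (fun w => 2%:E * \int[lebesgue_measure]_s p w s)%E.
  exact: measurable_funeM.
have M2n : measurable_fun setT (fun w => 2%:E * \int[lebesgue_measure]_s n w s)%E.
  exact: measurable_funeM.
(* An infinite risk of the constant estimator leaves nothing to prove; otherwise it dominates the
   layers n. *)
have [->|fin] := eqVneq (\int[P]_w ((Z w - c) ^+ 2)%:E)%E +oo%E; first exact: leey.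
have finE : (\int[P]_w ((Z w - c) ^+ 2)%:E)%E \is a fin_num.
  by rewrite ge0_fin_numE ?integral_ge0// ltey.
have nfin : (\int[P]_w (2%:E * \int[lebesgue_measure]_s n w s))%E \is a fin_num.
  rewrite ge0_fin_numE; last by apply: integral_ge0 => w _; rewrite mule_ge0.
  apply: (@le_lt_trans _ _ (\int[P]_w ((Z w - c) ^+ 2)%:E)%E); last by rewrite ltey.
  apply: ge0_le_integral => //; first by move=> w _; rewrite mule_ge0.
  by move=> w _; exact: layer_le_square.
(* Adding the finite 2 E[n] on both sides turns the layer cake identity into one between sums of
   nonnegative terms, with no subtraction. *)
rewrite -(leeD2rE _ _ nfin) -ge0_integralD//; last by move=> w _; rewrite mule_ge0.
have layers w : (((Z w - V w) ^+ 2)%:E + 2%:E * \int[lebesgue_measure]_s n w s =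
    ((Z w - c) ^+ 2)%:E + 2%:E * \int[lebesgue_measure]_s p w s)%E.
  exact: square_layer_cake.
under eq_integral do rewrite layers.
rewrite ge0_integralD//; last by move=> w _; rewrite mule_ge0.
rewrite leeD2lE// !ge0_integralZl//.
by apply: lee_wpmul2l.
Qed.

Theorem theorem3p4 (d : measure_display) (T : measurableType d) (R : realType)
    (f : R -> R) (P : R * R -> probability T R) (X1 X2 : {mfun T >-> R})
    (phi : R -> R)
    (hf : prob_density f)
    (hX : location_model P X1 X2 f)
    (hfin_phi : forall theta : R * R,
      (risk P X1 X2 theta (delta_phi phi) < +oo)%E)
    (hfin_b0 : forall theta : R * R,
      (risk P X1 X2 theta (delta_const (b0 f)) < +oo)%E)
    (hmlr : mlr f)
    (hphi_incr : forall s t : R, 0 <= s -> s <= t -> phi s <= phi t)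
    (hphi_lim : phi t @[t --> +oo] --> b0 f)
    (hphi_bound : forall t : R, 0 < t -> phi_bound f t <= phi t) :
  forall theta : R * R,
    (risk P X1 X2 theta (delta_phi phi)
       <= risk P X1 X2 theta (delta_const (b0 f)))%E.
Proof.
move=> theta.
have phi_le u : 0 <= u -> phi u <= b0 f.
  move=> u0; apply: (cvgr_to_ge hphi_lim); near=> t.
  apply: hphi_incr => //; near: t; exact: nbhs_pinfty_ge (num_real u).
have phi_ge s : s < b0 f -> exists2 M, 0 <= M & s <= phi M.
  move=> sb; have [M [M0 sM]] : exists M, 0 <= M /\ s <= phi M.
    apply: (@filter_ex _ +oo); near=> t; split; near: t.
      exact: nbhs_pinfty_ge (num_real 0).
    exact: cvgr_ge sb.
  by exists M.
(* At equal parameters the density of Z on {U <= t} is 2 f W, so finite risk there bounds the second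
   moment of f W. *)
pose o : R * R := (0, 0).
have fin t : (\int[lebesgue_measure]_z
    (((z - b0 f) ^+ 2)%:E * (f z * window f t z)%R%:E) < +oo)%E.
  have [mf f0 _] := hf; have w0 z := window_ge0 t z hf.
  have [dX dY iXY] := hX o.
  have mq : measurable_fun [set: R] (fun z => ((z - b0 f) ^+ 2)%:E).
    by apply/measurable_EFinP; apply: measurable_funX; exact: measurable_funB.
  have q0 (z : R) : (0 <= ((z - b0 f) ^+ 2)%:E)%E by rewrite lee_fin sqr_ge0.
  have mw := measurable_window t hf.
  apply: le_lt_trans (hfin_b0 o); rewrite /risk unlock.
  apply: (@le_trans _ _ (\int[P o]_w
    (if (Num.max (X1 w) (X2 w) - Num.min (X1 w) (X2 w) <= t)%R
     then ((Num.max (X1 w) (X2 w) - 0 - b0 f) ^+ 2)%:E else 0)))%E.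
    rewrite (expectation_max_range t hf dX dY iXY mq q0).
    apply: ge0_le_integral => //.
    - by move=> z _; rewrite mule_ge0// lee_fin mulr_ge0.
    - apply: emeasurable_funM => //; apply/measurable_EFinP.
      exact: measurable_funM.
    - apply: emeasurable_funM => //; apply/measurable_EFinP.
      by apply: measurable_funD; apply: measurable_funM => //; exact: measurable_shift.
    - move=> z _; apply: lee_wpmul2l => //.
      by rewrite lee_fin /= subrr !addr0 lerDl mulr_ge0.
  have mmax : measurable_fun setT (fun w => Num.max (X1 w) (X2 w)).
    exact: measurable_maxr.
  have mmin : measurable_fun setT (fun w => Num.min (X1 w) (X2 w)).
    exact: measurable_minr.
  apply: ge0_le_integral => //.
  - by move=> w _; case: ifP.
  - apply: measurable_fun_ifT => //.
      by apply: measurable_fun_ler => //; exact: measurable_funB.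
    apply/measurable_EFinP; apply: measurable_funX.
    by do 2 apply: measurable_funB => //.
  - apply/measurable_EFinP; apply: measurable_funX.
    by do 2 apply: measurable_funB => //.
  - move=> w _; rewrite /delta_const /= maxxx !subr0.
    by case: ifP => // _; rewrite lee_fin sqr_ge0.
have bal t s : 0 < t -> phi t < s ->
   (\int[lebesgue_measure]_z ((Num.max (z - s) 0)%:E * (f z * window f t z)%:E) <=
    \int[lebesgue_measure]_z ((Num.max (s - z) 0)%:E * (f z * window f t z)%:E))%E.
  move=> t0 ts; apply: (@phi_bound_balance _ _ _ (b0 f)) => //.
  exact: le_trans (hphi_bound t t0) (ltW ts).
have [dX dY iXY] := hX theta; rewrite /risk unlock /=.
have [ab|/ltW ba] := leP theta.1 theta.2.
  exact: (risk_le hf hmlr dX dY iXY ab hphi_incr phi_le phi_ge bal).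
(* The estimators are symmetric in the sample, so the other ordering of theta follows by exchanging
   the observations. *)
have iYX : independent_RVs (P theta) X2 X1.
  by move=> A B mA mB; rewrite setIC iXY// muleC.
have := risk_le hf hmlr dY dX iYX ba hphi_incr phi_le phi_ge bal.
by rewrite /delta_phi /delta_const/=; under eq_integral do rewrite maxC minC;
  under [X in (_ <= X)%E -> _]eq_integral do rewrite maxC.
Unshelve. all: by end_near. Qed.
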